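(* Let $1\le u_1,u_2\le\infty$. There is a constant $C$ independent of $q$ with $L_q(u_1,u_2)\le C$ for all odd prime powers $q$ if and only if $\frac{1}{u_1}+\frac{2}{u_2}\le2$ and $\frac{2}{u_1}+\frac{1}{u_2}\le 2$.
   Context: For $f_1,f_2:\mathbb{F}_q^2\to\mathbb{R}$ let $\mathcal{L}(f_1,f_2)=\frac{1}{q^3}\sum_{x=(x_1,x_2),\,y=(y_1,y_2)\in\mathbb{F}_q^2}\mathbf{1}_{x_1y_1+y_2=x_2}f_1(x)f_2(y)$. $L_q(u_1,u_2)$ is the smallest constant (or $\infty$ if none exists) such that $\mathcal{L}(f_1,f_2)\le L_q(u_1,u_2)\|f_1\|_{L^{u_1}(\mathbb{F}_q^2,dx)}\|f_2\|_{L^{u_2}(\mathbb{F}_q^2,dx)}$ for all nonnegative $f_1,f_2$. Norms are normalized: $\|f\|_{L^r(\mathbb{F}_q^2,dx)}=(q^{-2}\sum_x|f(x)|^r)^{1/r}$, $\|f\|_{L^\infty}=\max|f|$. *)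

(* Defs.v *)
From HB Require Import structures.
From mathcomp Require Import all_boot all_order all_algebra.
From mathcomp Require Import all_classical all_reals all_analysis.

Set Implicit Arguments.
Unset Strict Implicit.
Unset Printing Implicit Defensive.

Import Order.TTheory GRing.Theory Num.Theory.
Local Open Scope classical_set_scope.
Local Open Scope ring_scope.

Definition incidence_form (R : realType) (F : finFieldType)
    (f1 f2 : F * F -> R) : R :=
  (#|F|%:R ^+ 3)^-1 *
  \sum_(x : F * F) \sum_(y : F * F)
    (x.1 * y.1 + y.2 == x.2)%:R * f1 x * f2 y.

(* The norm of L^u(F^2, dx), where dx is the normalized counting measure;
   exponents are meant to lie in [1, +oo], and -oo gets a junk value. *)
Definition plane_norm (R : realType) (F : finFieldType) (u : \bar R)
    (f : F * F -> R) : R :=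
  match u with
  | r%:E => ((#|F|%:R ^+ 2)^-1 * \sum_(x : F * F) `|f x| `^ r) `^ r^-1
  | +oo%E => \big[Num.max/0]_(x : F * F) `|f x|
  | -oo%E => 0
  end.

Definition form_bounded_by (R : realType) (F : finFieldType) (u1 u2 : \bar R)
    (K : R) : Prop :=
  forall f1 f2 : F * F -> R,
    (forall x, 0 <= f1 x) -> (forall x, 0 <= f2 x) ->
    incidence_form f1 f2 <= K * plane_norm u1 f1 * plane_norm u2 f2.

(* The optimal constant L_q(u1, u2) with q = #|F|; the infimum of the empty
   set is +oo, and the infimum of a nonempty set of bounds is itself a bound. *)
Definition optimal_constant (R : realType) (F : finFieldType)
    (u1 u2 : \bar R) : \bar R :=
  ereal_inf [set K%:E | K in [set K : R | form_bounded_by F u1 u2 K]].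

(* Main.v *)
(* With a = 1/u1, b = 1/u2, positivity of the form reduces sufficiency to the
   vertices (0,0), (1,0), (0,1), (2/3,2/3) of the region: after normalizing,
   f1 = phi1^a and f2 = phi2^b with phi1, phi2 of mean at most 1, and pointwise
   phi1^a phi2^b <= 1 + phi1 + phi2 + (phi1 phi2)^(2/3).  Only the vertex (2/3,2/3) is not
   immediate.  There, with r = phi2^(1/3) and S_x the sum of r^2 on the line of
   x, one needs sum_x S_x^3 = O(q (sum r^3)^2).  Hoelder on each line bounds
   S_x^3 by q times a sum over pairs of points, and two distinct points lie on
   at most one line; the pairs of equal points, which lie on q lines, are
   avoided by first removing from each line the point where r is largest.
   Necessity is tested on the indicators of the origin and of the line
   {x_2 = 0}, each in either slot. *)
Require Import Defs.
From mathcomp Require Import all_boot all_order all_algebra.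
From mathcomp Require Import all_classical all_reals all_analysis.
From mathcomp Require Import ring lra.

Import Order.TTheory GRing.Theory Num.Theory.
Local Open Scope ring_scope.

(** * Hölder-type inequalities for finite sums *)

(** Hölder with exponents 3/2 and 3, cubed so that no roots appear. It follows by summing Young's
    inequality [3 l h^2 <= 2 h^3 + l^3] and optimizing [l]. *)
Lemma sum_sqr_cube_le (R : realFieldType) (T : finType) (P : pred T)
    (h : T -> R) (h0 : forall t, 0 <= h t) :
  (\sum_(t | P t) h t ^+ 2) ^+ 3 <= #|P|%:R * (\sum_(t | P t) h t ^+ 3) ^+ 2.
Proof.
set A := \sum_(t | P t) h t ^+ 3; set B := \sum_(t | P t) h t ^+ 2.
have A0 : 0 <= A by apply: sumr_ge0 => t _; exact: exprn_ge0.
have B0 : 0 <= B by apply: sumr_ge0 => t _; exact: exprn_ge0.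
have young (l : R) : 0 <= l -> 3 * l * B <= 2 * A + #|P|%:R * l ^+ 3.
  move=> l0; rewrite /A /B [X in X <= _]mulr_sumr [X in X + _]mulr_sumr.
  rewrite (_ : _ * l ^+ 3 = \sum_(t | P t) l ^+ 3); last first.
    by rewrite mulr_natl -sumr_const.
  rewrite -big_split /=.
  apply: ler_sum => t _; have := h0 t; move: (h t) => x x0.
  rewrite -subr_ge0 [leRHS](_ : _ = (x - l) ^+ 2 * (2 * x + l)); last by ring.
  by rewrite mulr_ge0 ?sqr_ge0 ?addr_ge0 ?mulr_ge0.
have [B_eq0|Bn0] := eqVneq B 0.
  by rewrite B_eq0 expr0n /= mulr_ge0 ?ler0n ?sqr_ge0.
have Bp : 0 < B by rewrite lt_def Bn0.
have Ap : 0 < A.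
  rewrite lt_def A0 andbT; apply: contra_neq Bn0 => /psumr_eq0P hA.
  apply: big1 => t Pt; have /eqP := hA (fun i _ => exprn_ge0 3 (h0 i)) t Pt.
  by rewrite expf_eq0 /= => /eqP ->; rewrite expr0n.
(* With [l = A / B] the left side is [3 A], leaving [A <= #|P| (A / B)^3]. *)
have := young (A / B) (divr_ge0 A0 B0).
rewrite (_ : 3 * (A / B) * B = 3 * A); last by field.
move=> H; have {H} : A <= #|P|%:R * (A / B) ^+ 3 by lra.
rewrite expr_div_n mulrA ler_pdivlMr ?exprn_gt0 // [A ^+ 3]exprS.
by rewrite [_%:R * _]mulrCA ler_pM2l.
Qed.

(** The factor [#|T|] falls only on pairs of distinct points. Plain Hölder would also put it on the
    diagonal terms [h t ^+ 6], which costs an extra factor q after summation over lines. *)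
Lemma line_cube_le (R : realFieldType) (T : finType) (h : T -> R)
    (h0 : forall t, 0 <= h t) :
  (\sum_t h t ^+ 2) ^+ 3 <= 4 * (\sum_t h t ^+ 6 +
    #|T|%:R * \sum_t \sum_(s | s != t) h t ^+ 3 * h s ^+ 3).
Proof.
have [m0 _|T0] := pickP (@predT T); last first.
  rewrite !big_pred0 // expr0n /= mulr_ge0 // addr_ge0 // mulr_ge0 //.
set m := [arg max_(i > m0) h i]%O.
have hm t : h t <= h m.
  by rewrite /m; case: arg_maxP => // i _ /(_ t isT).
rewrite (bigD1 m) //=.
set S := \sum_(t | t != m) h t ^+ 2.
have S0 : 0 <= S by apply: sumr_ge0 => t _; exact: exprn_ge0.
have H6 : h m ^+ 6 <= \sum_t h t ^+ 6.
  by rewrite (bigD1 m) //= lerDl sumr_ge0 // => t _; exact: exprn_ge0.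
have h3 t : 0 <= h t ^+ 3 by exact: exprn_ge0.
have HD : (\sum_(t | t != m) h t ^+ 3) ^+ 2
    <= \sum_t \sum_(s | s != t) h t ^+ 3 * h s ^+ 3.
  rewrite [leRHS](bigD1 m) //= expr2 mulr_suml.
  apply: le_trans (_ : \sum_(t | t != m) \sum_(s | s != t) h t ^+ 3 * h s ^+ 3
    <= _); last by rewrite lerDr; apply: sumr_ge0 => s _; exact: mulr_ge0.
  (* The diagonal term h t ^ 6 is absorbed by the missing pair (t, m). *)
  apply: ler_sum => t tm; rewrite mulr_sumr (bigD1 t) //=.
  rewrite [leRHS](bigD1 m) 1?eq_sym //=; apply: lerD.
    by rewrite ler_wpM2l // lerXn2r ?nnegrE.
  by rewrite le_eqVlt; apply/orP; left; apply/eqP/eq_bigl => s; rewrite andbC.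
have HS : S ^+ 3 <= #|T|%:R *
    \sum_t \sum_(s | s != t) h t ^+ 3 * h s ^+ 3.
  apply: le_trans (sum_sqr_cube_le _ _ _ h h0) _.
  by rewrite ler_pM ?sqr_ge0 // ler_nat max_card.
(* Convexity of the cube, applied to [h m ^+ 2] and [S]. *)
apply: le_trans (_ : 4 * (h m ^+ 6 + S ^+ 3) <= _); last first.
  by rewrite ler_wpM2l // lerD.
have := sqr_ge0 (h m); move: (h m ^+ 2) (exprM (h m) 2 3) => x -> x0.
rewrite -subr_ge0 (_ : _ - _ = 3 * (x + S) * (x - S) ^+ 2); last by ring.
by rewrite mulr_ge0 ?sqr_ge0 // mulr_ge0 ?addr_ge0.
Qed.

(** * Sums over lines and the vertex (2/3, 2/3) *)

Section Lines.
Context (R : realType) (F : finFieldType).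
Local Notation q := (#|F|%:R : R).
Implicit Types g k : F * F -> R.

Lemma sum_plane g : \sum_y g y = \sum_t \sum_s g (t, s).
Proof. by rewrite pair_bigA; apply: eq_bigr => -[]. Qed.

(** The point [x] encodes the non-vertical line of slope [- x.1] and intercept [x.2], parametrized
    by its first coordinate [t]. *)
Lemma incidence_formE f1 f2 : incidence_form (f1 : F * F -> R) f2 =
  (q ^+ 3)^-1 * \sum_x f1 x * \sum_t f2 (t, x.2 - x.1 * t).
Proof.
congr (_ * _); apply: eq_bigr => x _; rewrite sum_plane mulr_sumr.
apply: eq_bigr => t _ /=; rewrite (bigD1 (x.2 - x.1 * t)) //= big1 => [|s sx].
  by rewrite addr0 addrC subrK eqxx mul1r.
case: eqP => [E|_]; last by rewrite !mul0r.
by rewrite -E [_ * _ + s]addrC addrK eqxx in sx.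
Qed.

(** Each point lies on exactly one line of each slope, hence on q lines. *)
Lemma sum_lines g :
  \sum_(x : F * F) \sum_t g (t, x.2 - x.1 * t) = q * \sum_y g y.
Proof.
rewrite [LHS]sum_plane mulr_natl -sumr_const; apply: eq_big => // a _.
rewrite exchange_big sum_plane; apply: eq_bigr => t _ /=.
by rewrite [RHS](reindex_inj (addIr (- (a * t)))).
Qed.

(** A non-vertical line is determined by its ordinates over [t] and [s], which are arbitrary; [psi]
    recovers slope and intercept from them. *)
Lemma sum_lines_through g k (t s : F) : s != t ->
  \sum_(x : F * F) g (t, x.2 - x.1 * t) * k (s, x.2 - x.1 * s) =
  (\sum_c g (t, c)) * \sum_d k (s, d).
Proof.
move=> st; rewrite big_distrlr pair_bigA /=.
have st0 : s - t != 0 by rewrite subr_eq0.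
pose phi (x : F * F) := (x.2 - x.1 * t, x.2 - x.1 * s).
pose psi (z : F * F) :=
  ((z.1 - z.2) / (s - t), z.1 + (z.1 - z.2) / (s - t) * t).
rewrite [RHS](reindex phi) //; apply/onW_bij; exists psi.
  by case=> a b; rewrite /phi /psi /=; congr pair; field.
by case=> a b; rewrite /phi /psi /=; congr pair; field.
Qed.

(** The L^(3/2) to L^3 bound for summation over lines, applied to [r ^+ 2]. Diagonal terms and
    distinct pairs each contribute at most [4 q G^2]. *)
Lemma sum_lines_cube_le (r : F * F -> R) (r0 : forall y, 0 <= r y) :
  \sum_(x : F * F) (\sum_t r (t, x.2 - x.1 * t) ^+ 2) ^+ 3
    <= 8 * q * (\sum_y r y ^+ 3) ^+ 2.
Proof.
set G := \sum_y r y ^+ 3.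
have r3 y : 0 <= r y ^+ 3 by exact: exprn_ge0.
have G0 : 0 <= G by apply: sumr_ge0.
pose D := \sum_(x : F * F) \sum_t \sum_(s | s != t)
  r (t, x.2 - x.1 * t) ^+ 3 * r (s, x.2 - x.1 * s) ^+ 3.
have HD : D <= G ^+ 2.
  rewrite /D exchange_big /= expr2 {1}/G sum_plane mulr_suml.
  apply: ler_sum => t _; rewrite exchange_big /=.
  under eq_bigr => s st do rewrite (sum_lines_through (fun y => r y ^+ 3)
    (fun y => r y ^+ 3)) //.
  (* Adding back the points above [t] completes the second factor to [G]. *)
  rewrite -mulr_sumr ler_wpM2l ?sumr_ge0 // /G sum_plane.
  by rewrite [leRHS](bigD1 t) //= lerDr sumr_ge0.
have H6 : \sum_y r y ^+ 6 <= G ^+ 2.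
  rewrite expr2 {1}/G mulr_suml; apply: ler_sum => y _.
  rewrite (exprD _ 3 3) ler_wpM2l // /G (bigD1 y) //= lerDl.
  exact: sumr_ge0.
apply: le_trans (_ : \sum_(x : F * F) 4 * (\sum_t r (t, x.2 - x.1 * t) ^+ 6 +
    q * \sum_t \sum_(s | s != t)
      r (t, x.2 - x.1 * t) ^+ 3 * r (s, x.2 - x.1 * s) ^+ 3) <= _).
  by apply: ler_sum => x _; apply: line_cube_le.
rewrite -mulr_sumr big_split /= -mulr_sumr -/D.
rewrite (sum_lines (fun y => r y ^+ 6)) -mulrDr.
have -> : 8 * q * G ^+ 2 = 4 * (q * (G ^+ 2 + G ^+ 2)) by ring.
by rewrite !ler_wpM2l // lerD.
Qed.

(** A crude Young inequality: the product is at most the cube of the larger of [p] and [x]. *)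
Lemma sqr_mul_le (p x : R) : 0 <= p -> 0 <= x -> p ^+ 2 * x <= p ^+ 3 + x ^+ 3.
Proof.
move=> p0 x0; case: (leP x p) => [xp|/ltW px].
  by rewrite [p ^+ 3]exprSr (le_trans (ler_wpM2l (sqr_ge0 p) xp)) //
    lerDl exprn_ge0.
rewrite [x ^+ 3]exprSr (le_trans (ler_wpM2r x0 (_ : p ^+ 2 <= x ^+ 2))) //.
  by rewrite lerXn2r ?nnegrE.
by rewrite lerDr exprn_ge0.
Qed.

Lemma card_field_gt0 : 0 < q.
Proof. by rewrite ltr0n; apply/card_gt0P; exists 0. Qed.

Lemma incidence_sqr_le (p r : F * F -> R) :
  (forall x, 0 <= p x) -> (forall y, 0 <= r y) ->
  \sum_x p x ^+ 3 <= q ^+ 2 -> \sum_y r y ^+ 3 <= q ^+ 2 ->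
  incidence_form (fun x => p x ^+ 2) (fun y => r y ^+ 2) <= 9.
Proof.
move=> p0 r0 hp hr; have q0 := card_field_gt0.
rewrite incidence_formE ler_pdivrMl ?exprn_gt0 //.
pose S (x : F * F) := \sum_t r (t, x.2 - x.1 * t) ^+ 2.
have S0 x : 0 <= S x by apply: sumr_ge0 => t _; exact: exprn_ge0.
apply: le_trans (_ : \sum_x (q * p x ^+ 3 + (q ^+ 2)^-1 * S x ^+ 3) <= _).
  apply: ler_sum => x _.
  (* Comparing [p x] with the line average [S x / q] makes both sums of order q^3; the constant is 9
     = 1 + 8. *)
  have := ler_wpM2l (ltW q0) (sqr_mul_le (p x) (S x / q) (p0 x)
    (divr_ge0 (S0 x) (ltW q0))).
  rewrite (_ : q * (_ * (S x / q)) = p x ^+ 2 * S x).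
    rewrite (_ : q * (_ + (S x / q) ^+ 3) =
      q * p x ^+ 3 + (q ^+ 2)^-1 * S x ^+ 3) //.
    by field; rewrite lt0r_neq0.
  by field; rewrite lt0r_neq0.
rewrite big_split /= -!mulr_sumr.
have -> : q ^+ 3 * 9 = q * q ^+ 2 + (q ^+ 2)^-1 * (8 * q * (q ^+ 2) ^+ 2).
  by field; rewrite lt0r_neq0.
apply: lerD; first by rewrite ler_pM2l.
rewrite ler_pM2l ?invr_gt0 ?exprn_gt0 //.
apply: le_trans (sum_lines_cube_le r r0) _.
rewrite ler_wpM2l ?mulr_ge0 ?(ltW q0) //.
by rewrite lerXn2r ?nnegrE ?sumr_ge0 ?sqr_ge0 // => y _; rewrite exprn_ge0.
Qed.


(** * The other vertices and the normalization of functions *)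

(** Every line has q points; this gives the vertices (1,0) and (0,0). *)
Lemma incidence_form_cst_r (f : F * F -> R) :
  incidence_form f (fun=> 1) = (q ^+ 2)^-1 * \sum_x f x.
Proof.
rewrite incidence_formE -mulr_suml sumr_const.
by have := card_field_gt0 => q0; field; rewrite lt0r_neq0.
Qed.

Lemma incidence_form_cst_l (f : F * F -> R) :
  incidence_form (fun=> 1) f = (q ^+ 2)^-1 * \sum_y f y.
Proof.
rewrite incidence_formE; under eq_bigr do rewrite mul1r.
rewrite sum_lines.
by have := card_field_gt0 => q0; field; rewrite lt0r_neq0.
Qed.

Lemma plane_norm_ge0 u (f : F * F -> R) : 0 <= plane_norm u f.
Proof.
case: u => [r| |] //=; first exact: powR_ge0.
exact: bigmax_ge_id.
Qed.

(** Take [phi] to be [|f|^u] divided by its mean, or the constant 1 when [u] is infinite and the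
    exponent is 0. Finite and infinite [u] are then treated alike. *)
Lemma plane_norm_profile (u : \bar R) (f : F * F -> R) :
  (1 <= u)%E -> (forall x, 0 <= f x) ->
  exists phi : F * F -> R, [/\ forall x, 0 <= phi x,
    \sum_x phi x <= q ^+ 2 &
    forall x, f x <= plane_norm u f * phi x `^ fine u^-1%E].
Proof.
have q0 := card_field_gt0.
case: u => [r| |] //= hu f0; last first.
  exists (fun=> 1); split=> //.
    by rewrite sumr_const card_prod natrM.
  move=> x; rewrite powRr0 mulr1.
  by apply: le_trans (le_bigmax _ _ x); rewrite ler_norm.
rewrite lee_fin in hu.
have r0 : 0 < r by apply: lt_le_trans hu.
set m := _ * \sum_x _.
have fr0 x : 0 <= `|f x| `^ r by exact: powR_ge0.
have m0 : 0 <= m.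
  by rewrite mulr_ge0 ?sumr_ge0 // invr_ge0 exprn_ge0 // ltW.
(* If m = 0 then f = 0, and phi is 0 by the convention y / 0 = 0. *)
exists (fun x => `|f x| `^ r / m); split=> [x||x]; first exact: divr_ge0.
  rewrite -mulr_suml (_ : \sum_x _ = q ^+ 2 * m); last first.
    by rewrite mulrA divff ?mul1r // expf_neq0 // lt0r_neq0.
  have [->|mn0] := eqVneq m 0; first by rewrite invr0 mulr0 exprn_ge0 // ltW.
  by rewrite mulfK.
rewrite fine_invr -powRM ?divr_ge0 //.
have [m_eq0|mn0] := eqVneq m 0; last first.
  rewrite mulrC divfK // -powRrM divff ?lt0r_neq0 // powRr1 //.
  exact: ler_norm.
rewrite (_ : f x = 0) ?powR_ge0 //; apply/eqP; rewrite -normr_eq0.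
move/eqP: m_eq0; rewrite mulf_eq0 invr_eq0 expf_eq0 /= gt_eqF //= => /eqP.
move=> /psumr_eq0P - /(_ (fun i _ => fr0 i) x isT) /eqP.
by rewrite powR_eq0 => /andP[].
Qed.

(** * Interpolation between the vertices, and sufficiency *)

(** Here (a,b) lies in the triangle (0,0), (1,0), (2/3,2/3). The product is [(p^3)^(a-b)] times
    [(p^2 r^2)^(3b/2)]; both bases are at most [m >= 1], and the exponents add up to
    [a + b/2 <= 1]. *)
Lemma powR_mul_le_of_ge (a b p r : R) : 0 <= b -> b <= a -> 2 * a + b <= 2 ->
  0 <= p -> 0 <= r ->
  (p ^+ 3) `^ a * (r ^+ 3) `^ b <= 1 + p ^+ 3 + r ^+ 3 + p ^+ 2 * r ^+ 2.
Proof.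
move=> b0 ba ab p0 r0; set m := leRHS.
have [p3 r3] : 0 <= p ^+ 3 /\ 0 <= r ^+ 3 by split; apply: exprn_ge0.
have pr2 : 0 <= p ^+ 2 * r ^+ 2 by rewrite mulr_ge0 ?exprn_ge0.
have m1 : 1 <= m by rewrite /m; lra.
have m0 : 0 <= m by exact: le_trans m1.
have le_m c x : 0 <= c -> 0 <= x -> x <= m -> x `^ c <= m `^ c.
  by move=> c0 x0 xm; apply: ge0_ler_powR.
(* Once [b = 0] is settled, [a] is positive, so the power of [p ^+ 3] can be split even at
   [p = 0]. *)
have [b_eq0|bn0] := eqVneq b 0.
  rewrite b_eq0 powRr0 mulr1; apply: le_trans (ler1_powR _ (_ : a <= 1)) => //.
    by apply: le_m; rewrite // /m; lra.
  by lra.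
have an0 : a != 0 by rewrite lt0r_neq0 //; lra.
have -> : (p ^+ 3) `^ a * (r ^+ 3) `^ b =
    (p ^+ 3) `^ (a - b) * ((p ^+ 2 * r ^+ 2) `^ (3 / 2 * b)).
  rewrite (_ : (p ^+ 3) `^ a = (p ^+ 3) `^ (a - b) * (p ^+ 3) `^ b); last first.
    by rewrite -powRD subrK // (negPf an0).
  rewrite -mulrA -powRM // -!exprMn -!powR_mulrn ?mulr_ge0 // -!powRrM.
  by congr (_ * _ `^ _); field.
apply: le_trans (_ : m `^ (a - b) * m `^ (3 / 2 * b) <= _).
  by apply: ler_pM; rewrite ?powR_ge0 //; apply: le_m; rewrite // /m; lra.
rewrite -powRD; last by rewrite (gt_eqF (lt_le_trans ltr01 m1)) implybT.
by apply: ler1_powR => //; lra.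
Qed.

Lemma powR_mul_le (a b p r : R) : 0 <= a -> 0 <= b ->
  a + 2 * b <= 2 -> 2 * a + b <= 2 -> 0 <= p -> 0 <= r ->
  (p ^+ 3) `^ a * (r ^+ 3) `^ b <= 1 + p ^+ 3 + r ^+ 3 + p ^+ 2 * r ^+ 2.
Proof.
move=> a0 b0 ab1 ab2 p0 r0; have [ba|/ltW ab] := leP b a.
  exact: powR_mul_le_of_ge.
rewrite mulrC [p ^+ 2 * _]mulrC -[1 + _ + _]addrA [p ^+ 3 + _]addrC.
by rewrite [1 + (_ + _)]addrA; apply: powR_mul_le_of_ge => //; lra.
Qed.

(** The constant is 12 = 1 + 1 + 1 + 9, one bound for each vertex. *)
Lemma form_bounded_region (u1 u2 : \bar R) :
  (1 <= u1)%E -> (1 <= u2)%E ->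
  fine u1^-1%E + 2 * fine u2^-1%E <= 2 ->
  2 * fine u1^-1%E + fine u2^-1%E <= 2 -> form_bounded_by F u1 u2 (12 : R).
Proof.
move=> hu1 hu2; set a := fine u1^-1%E; set b := fine u2^-1%E => ab1 ab2.
have a0 : 0 <= a by rewrite fine_ge0 // inve_ge0 (le_trans _ hu1).
have b0 : 0 <= b by rewrite fine_ge0 // inve_ge0 (le_trans _ hu2).
move=> f1 f2 f10 f20; have q0 := card_field_gt0.
have [phi1 [phi1_ge0 sum1 le1]] := plane_norm_profile u1 f1 hu1 f10.
have [phi2 [phi2_ge0 sum2 le2]] := plane_norm_profile u2 f2 hu2 f20.
set N1 := plane_norm u1 f1 in le1 *; set N2 := plane_norm u2 f2 in le2 *.
have N10 : 0 <= N1 by exact: plane_norm_ge0.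
have N20 : 0 <= N2 by exact: plane_norm_ge0.
pose p x := phi1 x `^ 3^-1; pose r x := phi2 x `^ 3^-1.
have p0 x : 0 <= p x by exact: powR_ge0.
have r0 x : 0 <= r x by exact: powR_ge0.
have cube (t : R) : 0 <= t -> (t `^ 3^-1) ^+ 3 = t.
  by move=> t0; rewrite -powR_mulrn ?powR_ge0 // -powRrM mulVf // powRr1.
have p3 x : p x ^+ 3 = phi1 x by exact: cube.
have r3 x : r x ^+ 3 = phi2 x by exact: cube.
have le4 : incidence_form f1 f2 <= N1 * N2 *
    (@incidence_form R F (fun=> 1) (fun=> 1) + incidence_form phi1 (fun=> 1) +
     incidence_form (fun=> 1) phi2 +
     incidence_form (fun x => p x ^+ 2) (fun y => r y ^+ 2)).
  rewrite /incidence_form -!mulrDr mulrCA.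
  apply: ler_wpM2l; first by rewrite invr_ge0 exprn_ge0 // ltW.
  rewrite -!big_split mulr_sumr; apply: ler_sum => x _ /=.
  rewrite -!big_split mulr_sumr; apply: ler_sum => y _ /=.
  case: eqP => _; rewrite ?mul0r ?addr0 ?mulr0 // !mul1r mulr1.
  apply: le_trans (ler_pM _ _ (le1 x) (le2 y)) _ => //.
  rewrite mulrACA ler_wpM2l ?mulr_ge0 // -p3 -r3.
  exact: powR_mul_le.
apply: le_trans le4 _; rewrite mulrC -!mulrA.
rewrite ler_wpM2r ?mulr_ge0 // !incidence_form_cst_r incidence_form_cst_l.
have avg (s : R) : s <= q ^+ 2 -> (q ^+ 2)^-1 * s <= 1.
  by move=> hs; rewrite ler_pdivrMl ?exprn_gt0 // mulr1.
have h0 : (q ^+ 2)^-1 * \sum_(x : F * F) 1 <= 1.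
  by apply: avg; rewrite sumr_const card_prod natrM.
have h1 := avg _ sum1; have h2 := avg _ sum2.
have h3 : incidence_form (fun x => p x ^+ 2) (fun y => r y ^+ 2) <= 9.
  apply: incidence_sqr_le => //.
    by under eq_bigr do rewrite p3.
  by under eq_bigr do rewrite r3.
by lra.
Qed.

(** * Necessity: testing on indicators *)

(** The slack 1 yields an admissible constant below [C + 1] without proving that the infimum is
    attained. *)
Lemma optimal_constant_le_bounded (u1 u2 : \bar R) (C : R) :
  (optimal_constant F u1 u2 <= C%:E)%E -> form_bounded_by F u1 u2 (C + 1).
Proof.
move=> hC f1 f2 f10 f20.
have /ereal_inf_lt[_ [K hK <-]] : (optimal_constant F u1 u2 < (C + 1)%:E)%E.
  by apply: le_lt_trans hC _; rewrite lte_fin ltrDl.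
rewrite lte_fin => /ltW KC; apply: le_trans (hK f1 f2 f10 f20) _.
by rewrite !ler_wpM2r ?plane_norm_ge0.
Qed.

(** The witness [x0] serves infinite [u]: the right side is then a zeroth power, equal to 1, and so
    must be the maximum. *)
Lemma plane_norm_indicator (u : \bar R) (P : pred (F * F)) (x0 : F * F) :
  (1 <= u)%E -> P x0 -> plane_norm u (fun x => (P x)%:R) =
    ((q ^+ 2)^-1 * \sum_x (P x)%:R) `^ fine u^-1%E.
Proof.
case: u => [r| |] //=; last first.
  move=> _ Px0; rewrite powRr0; apply/eqP; rewrite eq_le; apply/andP; split.
    by apply: bigmax_le => // x _; rewrite normr_nat lern1 leq_b1.
  by apply: le_trans (le_bigmax _ _ x0); rewrite normr_nat Px0.
rewrite lee_fin => hr _; rewrite fine_invr; congr ((_ * _) `^ _).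
apply: eq_bigr => x _; rewrite normr_nat; case: (P x); first by rewrite powR1.
by rewrite powR0 // lt0r_neq0 // (lt_le_trans ltr01 hr).
Qed.

Lemma sum_origin : \sum_(x : F * F) (x == 0)%:R = 1 :> R.
Proof.
by rewrite (bigD1 (0 : F * F)) //= eqxx big1 ?addr0 // => x /negPf ->.
Qed.

Lemma sum_horizontal : \sum_(x : F * F) (x.2 == 0)%:R = q.
Proof.
rewrite sum_plane -sumr_const; apply: eq_big => // t _.
by rewrite (bigD1 0) //= eqxx big1 ?addr0 // => s /negPf ->.
Qed.

(** As a line, the origin is the horizontal axis itself, which gives q incidences. *)
Lemma incidence_form_origin_horizontal :
  (q ^+ 2)^-1 <= incidence_form (fun x : F * F => (x == 0)%:R : R)
                                (fun y => (y.2 == 0)%:R).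
Proof.
have q0 := card_field_gt0.
have -> : (q ^+ 2)^-1 = (q ^+ 3)^-1 * q by field; rewrite lt0r_neq0.
rewrite incidence_formE ler_pM2l ?invr_gt0 ?exprn_gt0 //.
rewrite (bigD1 (0 : F * F)) //= eqxx mul1r.
under eq_bigr do rewrite mul0r subr0 eqxx.
rewrite sumr_const lerDl sumr_ge0 // => x _.
by rewrite mulr_ge0 // sumr_ge0.
Qed.

(** The lines through the origin are the [x] with [x.2 = 0], again q incidences. *)
Lemma incidence_form_horizontal_origin :
  (q ^+ 2)^-1 <= incidence_form (fun x : F * F => (x.2 == 0)%:R : R)
                                (fun y => (y == 0)%:R).
Proof.
have q0 := card_field_gt0.
have -> : (q ^+ 2)^-1 = (q ^+ 3)^-1 * q by field; rewrite lt0r_neq0.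
rewrite incidence_formE ler_pM2l ?invr_gt0 ?exprn_gt0 // -sum_horizontal.
apply: ler_sum => x _; case: eqP => [x2|_]; last by rewrite mul0r.
rewrite mul1r (bigD1 0) //= x2 mulr0 subr0 eqxx lerDl sumr_ge0 // => t _.
Qed.

(** The indicators of the origin and of the axis have norms [q^(-2/u)] and [q^(-1/u)], while the
    form is at least [q^(-2)]. *)
Lemma form_bounded_card (u1 u2 : \bar R) (K : R) :
  (1 <= u1)%E -> (1 <= u2)%E -> form_bounded_by F u1 u2 K ->
  q `^ (2 * fine u1^-1%E + fine u2^-1%E - 2) <= K /\
  q `^ (fine u1^-1%E + 2 * fine u2^-1%E - 2) <= K.
Proof.
move=> hu1 hu2 hK; have q0 := card_field_gt0.
have qn0 : q != 0 by rewrite lt0r_neq0.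
have norm0 u : (1 <= u)%E -> plane_norm u (fun x : F * F => (x == 0)%:R) =
    q `^ (- 2 * fine u^-1%E).
  move=> hu; rewrite (plane_norm_indicator u (pred1 0) 0) //= sum_origin.
  by rewrite mulr1 powRrM powRN powR_mulrn // ltW.
have normh u : (1 <= u)%E -> plane_norm u (fun x : F * F => (x.2 == 0)%:R) =
    q `^ (- fine u^-1%E).
  move=> hu; rewrite (plane_norm_indicator u (fun x => x.2 == 0) 0) //=.
  rewrite sum_horizontal (_ : (q ^+ 2)^-1 * q = q^-1); last by field.
  by rewrite -powR_inv1 ?ltW // -powRrM mulN1r.
have qD s t : q `^ (s + t) = q `^ s * q `^ t by rewrite powRD ?qn0 ?implybT.
have q2 : q `^ (- 2) = (q ^+ 2)^-1 by rewrite powRN powR_mulrn // ltW.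
have step s t : (q ^+ 2)^-1 <= K * q `^ s * q `^ t -> q `^ (- s - t - 2) <= K.
  rewrite -mulrA -qD => h; rewrite -opprD !qD q2 powRN mulrC.
  by rewrite ler_pdivrMr ?powR_gt0.
split.
  rewrite (_ : _ - 2 = - (- 2 * fine u1^-1%E) - (- fine u2^-1%E) - 2);
    last by ring.
  apply: step; rewrite -norm0 // -normh //.
  exact: le_trans incidence_form_origin_horizontal (hK _ _ _ _).
rewrite (_ : _ - 2 = - (- fine u1^-1%E) - (- 2 * fine u2^-1%E) - 2);
    last by ring.
apply: step; rewrite -norm0 // -normh //.
exact: le_trans incidence_form_horizontal_origin (hK _ _ _ _).
Qed.

End Lines.

(** * Letting q grow, and the equivalence *)

Lemma exponent_le0 (R : realType) (e K : R) :
  (forall p, prime p -> odd p -> p%:R `^ e <= K) -> e <= 0.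
Proof.
move=> hK; rewrite leNgt; apply/negP => e0.
have K0 : 0 <= K by apply: le_trans (hK 3 isT isT); exact: powR_ge0.
pose n := Num.bound (K `^ e^-1).
(* A prime beyond [K^(1/e)] violates the bound; exceeding 2 makes it odd. *)
have [p np pp] := prime_above (maxn 2 n).
have [p2 {}np] : (2 < p)%N /\ (n < p)%N by apply/andP; rewrite -gtn_max.
have op : odd p by case: (even_prime pp) p2 => [->|].
have := hK p pp op; apply/negP; rewrite -ltNge.
have Kp : K `^ e^-1 < p%:R.
  apply: lt_le_trans (archi_boundP (powR_ge0 _ _)) _.
  by rewrite ler_nat ltnW.
have -> : K = (K `^ e^-1) `^ e by rewrite -powRrM mulVf ?lt0r_neq0 // powRr1.
by apply: gt0_ltr_powR; rewrite // nnegrE ?powR_ge0.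
Qed.

Lemma inve_fineE (R : realType) (u : \bar R) : (1 <= u)%E ->
  (u^-1 = (fine u^-1)%:E)%E.
Proof.
by move=> hu; rewrite fineK // fin_numV //; move: u hu => [r| |] //=;
  rewrite lee_fin => /(lt_le_trans ltr01) /lt0r_neq0.
Qed.

Local Open Scope ereal_scope.

Theorem theorem3p3 (R : realType) (u1 u2 : \bar R)
    (hu1 : 1 <= u1) (hu2 : 1 <= u2) :
  (exists C : R, forall F : finFieldType, odd #|F| ->
     optimal_constant F u1 u2 <= C%:E) <->
  (u1^-1 + 2 * u2^-1 <= 2 /\ 2 * u1^-1 + u2^-1 <= 2).
Proof.
rewrite (inve_fineE _ _ hu1) (inve_fineE _ _ hu2) -!EFinM -!EFinD !lee_fin.
split=> [[C hC]|[ab1 ab2]]; last first.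
  exists 12%R => F _; apply: ereal_inf_lbound; exists 12%R => //.
  exact: form_bounded_region.
(* Prime fields already provide arbitrarily large odd q. *)
have bound p : prime p -> odd p ->
    (p%:R `^ (2 * fine u1^-1 + fine u2^-1 - 2) <= C + 1 /\
     p%:R `^ (fine u1^-1 + 2 * fine u2^-1 - 2) <= C + 1)%R.
  move=> pp op; have := hC 'F_p; rewrite card_Fp // => /(_ op).
  move=> /optimal_constant_le_bounded /(form_bounded_card _ _ _ _ _ hu1 hu2).
  by rewrite card_Fp.
by split; rewrite -subr_le0; apply: (@exponent_le0 R _ (C + 1)) => p pp op;
  case: (bound p pp op).
Qed.
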